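(* Let $(a_l)_{l\in\mathbb{Z}_+}$ and $(b_l)_{l\in\mathbb{Z}_+}$ be the fixed real sequences described in the context. For $u\in\mathcal{B}(\mathbb{J})$ let $$Eu(x):=\begin{cases} u(x), & x\ge 0,\\ \sum_{l=0}^{+\infty} a_l\,u(b_l x), & x<0.\end{cases}$$ Then the linear extension operator $$\widetilde{E}:\mathcal{G}_{\mathcal{B}}(\mathbb{J})\longrightarrow \mathcal{G}_{\mathcal{B}}(\mathbb{R}),\qquad \widetilde{u}=[(u_\varepsilon)_\varepsilon]\longmapsto \widetilde{E}\widetilde{u}:=[(Eu_\varepsilon)_\varepsilon],$$ is well defined, and $\widetilde{E}\widetilde{u}_{|\mathbb{J}}=\widetilde{u}$ for every $\widetilde{u}\in\mathcal{G}_{\mathcal{B}}(\mathbb{J})$. In particular, for every $\widetilde{u}\in\mathcal{G}_{+,0}(\mathbb{J})$ one has $\widetilde{E}\widetilde{u}\in\mathcal{G}_{+,0}(\mathbb{R})$.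
   Context: Notation: $\mathbb{Z}_+=\{0,1,2,\dots\}$, $I:=\,]0,1]$, $\mathbb{J}:=[0,+\infty[$, and $\mathbb{I}$ denotes $\mathbb{R}$ or $\mathbb{J}$. The sequences: $(a_l)_{l\in\mathbb{Z}_+}$, $(b_l)_{l\in\mathbb{Z}_+}$ are real sequences (which exist by a lemma of Seeley) such that (1) $b_l<0$ for all $l$; (2) $\sum_{l=0}^{+\infty}|a_l||b_l|^n<+\infty$ for all $n\in\mathbb{Z}_+$; (3) $\sum_{l=0}^{+\infty}a_lb_l^n=1$ for all $n\in\mathbb{Z}_+$; (4) $b_l\to-\infty$ as $l\to+\infty$. $\mathcal{B}(\mathbb{I})$ is the space of smooth complex-valued functions $\varphi$ on $\mathbb{I}$ (up to the boundary point $0$, with one-sided derivatives, if $\mathbb{I}=\mathbb{J}$) with $\varphi^{(j)}\in L^\infty(\mathbb{I})$ for all $j\in\mathbb{Z}_+$; set $|\varphi|_{k,\infty,\mathbb{I}}:=\sum_{j\le k}\|\varphi^{(j)}\|_{L^\infty(\mathbb{I})}$. $\mathcal{B}_{+,0}(\mathbb{I})$ is the set of $\varphi\in\mathcal{B}(\mathbb{I})$ with $\lim_{x\to+\infty}\varphi^{(j)}(x)=0$ for all $j\in\mathbb{Z}_+$. For $X=\mathcal{B}(\mathbb{I})$ or $X=\mathcal{B}_{+,0}(\mathbb{I})$, let $\mathcal{M}_X$ be the set of nets $(u_\varepsilon)_{\varepsilon\in I}\in X^I$ such that for all $k\in\mathbb{Z}_+$ there is $m\in\mathbb{Z}_+$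 with $|u_\varepsilon|_{k,\infty,\mathbb{I}}=O(\varepsilon^{-m})$ as $\varepsilon\to0$, and $\mathcal{N}_X$ the set of nets in $X^I$ such that for all $k\in\mathbb{Z}_+$ and all $m\in\mathbb{Z}_+$, $|u_\varepsilon|_{k,\infty,\mathbb{I}}=O(\varepsilon^{m})$ as $\varepsilon\to0$. Define $\mathcal{G}_{\mathcal{B}}(\mathbb{I}):=\mathcal{M}_{\mathcal{B}(\mathbb{I})}/\mathcal{N}_{\mathcal{B}(\mathbb{I})}$ and $\mathcal{G}_{+,0}(\mathbb{I}):=\mathcal{M}_{\mathcal{B}_{+,0}(\mathbb{I})}/\mathcal{N}_{\mathcal{B}_{+,0}(\mathbb{I})}$ (viewed inside $\mathcal{G}_{\mathcal{B}}(\mathbb{I})$). $[(u_\varepsilon)_\varepsilon]$ denotes the class of $(u_\varepsilon)_\varepsilon$. Restriction to $\mathbb{J}$ is $[(u_\varepsilon)_\varepsilon]_{|\mathbb{J}}:=[(u_{\varepsilon|\mathbb{J}})_\varepsilon]\in\mathcal{G}_{\mathcal{B}}(\mathbb{J})$. *)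

(* Defs.v *)
From HB Require Import structures.
From mathcomp Require Import all_boot all_order all_algebra.
From mathcomp Require Import generic_quotient ring_quotient complex.
From mathcomp Require Import all_classical all_reals all_analysis.
From mathcomp Require Import ess_sup_inf measurable_realfun.
Set Implicit Arguments.
Unset Strict Implicit.
Unset Printing Implicit Defensive.
Import Order.TTheory GRing.Theory Num.Theory.
Import numFieldNormedType.Exports.
Local Open Scope classical_set_scope.
Local Open Scope ring_scope.
Local Open Scope complex_scope.
Local Open Scope quotient_scope.

(* The usual topology and norm on R[i]: the generic ones of a numFieldType,
   which the library only attaches to abstract number fields. *)
HB.instance Definition _ (R : realType) :=
  PseudoPointedMetric.copy R[i] R[i]^o.
HB.instance Definition _ (R : realType) := GRing.ComAlgebra.copy R[i] R[i]^o.
HB.instance Definition _ (R : realType) := NormedModule.copy R[i] R[i]^o.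
HB.instance Definition _ (R : realType) := Num.ClosedField.on R[i].

Inductive domain := Line | HalfLine.

Definition domset (R : realType) (d : domain) : set R :=
  match d with Line => setT | HalfLine => `[0, +oo[ end.

Arguments domset : clear implicits.

Notation dfun R d := (set_type (domset R d) -> R[i]).

Notation epsilons R := (set_type (`]0%R, 1%R] : set R)).

Section FunctionSpaces.
Context {R : realType} {d : domain}.
Implicit Types f g : dfun R d.

Definition zero_ext f : R -> R[i] := 'valL_ 0 f.

Definition diff_quot f (x y : R) : R[i] :=
  (zero_ext f y - zero_ext f x) / (y - x)%:C.

(* y stays in the domain, so at the boundary point 0 of [0, +oo[ these are the
   one-sided notions. *)
Definition differentiable_on f : Prop := forall x : domset R d,
  cvg (diff_quot f (val x) y @[y --> within (domset R d) (val x)^']).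

Definition cderiv f : dfun R d := fun x =>
  lim (diff_quot f (val x) y @[y --> within (domset R d) (val x)^']).

Definition cderivn (j : nat) f : dfun R d := iter j cderiv f.

Definition smooth f : Prop := forall j, differentiable_on (cderivn j f).

(* L^oo over the domain is computed on R after extension by zero. *)
Definition Linf_norm f : \bar R :=
  Lnorm lebesgue_measure +oo%E (fun x => (Normc.normc (zero_ext f x))%:E).

Definition Linfty f : Prop :=
  [/\ measurable_fun setT (fun x => complex.Re (zero_ext f x)),
      measurable_fun setT (fun x => complex.Im (zero_ext f x)) &
      (Linf_norm f < +oo)%E].

Definition seminorm (k : nat) f : \bar R :=
  (\sum_(j < k.+1) Linf_norm (cderivn j f))%E.

Definition Bset : set (dfun R d) :=
  [set f | smooth f /\ forall j, Linfty (cderivn j f)].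

Definition B0set : set (dfun R d) :=
  [set f | Bset f /\
    forall j, zero_ext (cderivn j f) x @[x --> +oo%R] --> (0 : R[i])].

End FunctionSpaces.

(* The linear subspaces of B(D) over which nets are taken. *)
Record fspace (R : realType) (d : domain) := FSpace {
  fcarrier :> dfun R d -> Prop;
  fspace_sub : forall f, fcarrier f -> Bset f;
  fspace0 : fcarrier 0;
  fspaceP : forall (c : R[i]) f g,
    fcarrier f -> fcarrier g -> fcarrier (c *: f + g) }.

Section SpaceTheory.
Context {R : realType} {d : domain}.
Implicit Types f g : dfun R d.

Lemma valL_lin (U : Type) (A : set U) (K : nzRingType) (V : lmodType K) (c : K)
    (f g : A -> V) (y : U) :
  'valL_ 0 (c *: f + g) y = c *: ('valL_ 0 f y) + 'valL_ 0 g y.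
Proof.
by rewrite /valL_ /=; case: ('oinv_set_val y) => [z|] //=; rewrite scaler0 addr0.
Qed.

Lemma valL_in (U V : Type) (A : set U) (v : V) (f : A -> V) (x : A) :
  'valL_ v f (val x) = f x.
Proof. by rewrite -[in RHS](valLK v f). Qed.

Lemma valL_out (U V : Type) (A : set U) (v : V) (f : A -> V) (x : U) :
  ~ A x -> 'valL_ v f x = v.
Proof.
move=> nAx.
have uA : x \notin A by apply/negP => /set_mem.
by rewrite /valL_ oinv_set_val /= insubN.
Qed.

Lemma zero_ext_lin (c : R[i]) f g y :
  zero_ext (c *: f + g) y = c * zero_ext f y + zero_ext g y.
Proof. exact: valL_lin. Qed.

Lemma domset_right (x y : R) : domset R d x -> x < y -> domset R d y.
Proof.
case: d => //=; rewrite !in_itv /= !andbT => x0 /ltW; exact: le_trans.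
Qed.

Lemma domset_filter (x : domset R d) : ProperFilter (within (domset R d) (val x)^').
Proof.
apply: Build_ProperFilter_ex => A; rewrite /within /dnbhs /= => H.
have xD : domset R d (val x) by exact: set_valP.
have /filter_ex// : ((val x)^'+ A).
rewrite /at_right /within /=; near=> y => xy.
suff: y != val x -> domset R d y -> A y.
  by apply; [rewrite gt_eqF | exact: domset_right xy].
by near: y; exact: H.
Unshelve. all: by end_near.
Qed.

Lemma diff_quot_lin (c : R[i]) f g (x y : R) :
  diff_quot (c *: f + g) x y = c * diff_quot f x y + diff_quot g x y.
Proof.
rewrite /diff_quot !zero_ext_lin mulrA -mulrDl; congr (_ / _).
by rewrite mulrBr opprD addrACA.
Qed.

Lemma cderiv_cvg f (x : domset R d) : differentiable_on f ->
  diff_quot f (val x) y @[y --> within (domset R d) (val x)^'] --> cderiv f x.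
Proof. exact. Qed.

Lemma cvg_cderiv f (l : dfun R d) :
  (forall x : domset R d,
    diff_quot f (val x) y @[y --> within (domset R d) (val x)^'] --> l x) ->
  differentiable_on f /\ cderiv f = l.
Proof.
move=> fl; split; first by move=> x; apply/cvg_ex; exists (l x); exact: fl.
apply/funext => x; have FF := domset_filter x.
by apply: cvg_lim; [exact: norm_hausdorff | exact: fl].
Qed.

Lemma cderiv_lin (c : R[i]) f g : differentiable_on f -> differentiable_on g ->
  differentiable_on (c *: f + g) /\ cderiv (c *: f + g) = c *: cderiv f + cderiv g.
Proof.
move=> df dg; apply: cvg_cderiv => x; have FF := domset_filter x.
under eq_fun do rewrite diff_quot_lin.
by apply: cvgD; [apply: cvgMr|]; exact: cderiv_cvg.
Qed.

Lemma cderivn_lin (c : R[i]) f g j : smooth f -> smooth g ->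
  cderivn j (c *: f + g) = c *: cderivn j f + cderivn j g.
Proof.
move=> sf sg; elim: j => // j; rewrite /cderivn /= => ->.
by have [] := cderiv_lin c (sf j) (sg j).
Qed.

Lemma smooth_lin (c : R[i]) f g : smooth f -> smooth g -> smooth (c *: f + g).
Proof.
move=> sf sg j; rewrite cderivn_lin//.
by have [] := cderiv_lin c (sf j) (sg j).
Qed.

Lemma zero_ext0 y : zero_ext (0 : dfun R d) y = 0.
Proof. by rewrite /zero_ext /valL_ /=; case: ('oinv_set_val y). Qed.

Lemma cderiv0 : differentiable_on (0 : dfun R d) /\ cderiv (0 : dfun R d) = 0.
Proof.
apply: cvg_cderiv => x; have FF := domset_filter x.
under eq_fun do rewrite /diff_quot !zero_ext0 subrr mul0r.
exact: cvg_cst.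
Qed.

Lemma cderivn0 j : cderivn j (0 : dfun R d) = 0.
Proof. by elim: j => // j; rewrite /cderivn /= => ->; rewrite cderiv0.2. Qed.

Lemma normcD (z w : R[i]) : Normc.normc (z + w) <= Normc.normc z + Normc.normc w.
Proof. exact: le_normcD. Qed.

Lemma normc_ge0 (z : R[i]) : 0 <= Normc.normc z.
Proof. by case: z => a b /=; exact: sqrtr_ge0. Qed.

Lemma leb_gt0 : (0 < @lebesgue_measure R setT)%E.
Proof.
have <- : @lebesgue_measure R `]-oo, +oo[ = @lebesgue_measure R setT.
  by rewrite set_itvNyy.
by rewrite lebesgue_measure_itv /= ?ltNye ?ltey //= addye // ltry.
Qed.

Lemma Linf_normE f :
  Linf_norm f = ess_sup lebesgue_measure
    (fun x => (Normc.normc (zero_ext f x))%:E).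
Proof.
rewrite /Linf_norm unlock /Lnorm leb_gt0; congr ess_sup.
by apply/funext => x /=; rewrite ger0_norm// normc_ge0.
Qed.

Lemma Linf_norm_ge0 f : (0 <= Linf_norm f)%E.
Proof. exact: Lnorm_ge0. Qed.

Lemma Linf_norm_lin (c : R[i]) f g :
  (Linf_norm (c *: f + g)%R <=
   (Normc.normc c)%:E * Linf_norm f + Linf_norm g)%E.
Proof.
rewrite !Linf_normE -ess_supZl ?leb_gt0 ?normc_ge0//.
apply: le_trans (ess_supD _ _ _); apply: le_ess_sup; apply: nearW => x /=.
rewrite zero_ext_lin -EFinM -EFinD lee_fin -Normc.normcM; exact: normcD.
Qed.

Lemma Linf_norm0 : Linf_norm (0 : dfun R d) = 0%E.
Proof.
rewrite Linf_normE; apply: ess_sup_ae_cst; first exact: leb_gt0.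
by apply: nearW => x; rewrite zero_ext0 Normc.normc0.
Qed.

Lemma Linfty_lin (c : R[i]) f g : Linfty f -> Linfty g -> Linfty (c *: f + g).
Proof.
move=> [fr fi fn] [gr gi gn]; split.
- under eq_fun do rewrite zero_ext_lin.
  rewrite (_ : (fun _ => _) = (fun x => (complex.Re c * complex.Re (zero_ext f x)
     - complex.Im c * complex.Im (zero_ext f x)) + complex.Re (zero_ext g x))).
    apply: measurable_funD => //; apply: measurable_funB;
    by apply: measurable_funM.
  by apply/funext => x; case: c (zero_ext f x) (zero_ext g x) => ? ? [? ?] [? ?].
- under eq_fun do rewrite zero_ext_lin.
  rewrite (_ : (fun _ => _) = (fun x => (complex.Re c * complex.Im (zero_ext f x)
     + complex.Im c * complex.Re (zero_ext f x)) + complex.Im (zero_ext g x))).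
    apply: measurable_funD => //; apply: measurable_funD;
    by apply: measurable_funM.
  by apply/funext => x; case: c (zero_ext f x) (zero_ext g x) => ? ? [? ?] [? ?].
- apply: le_lt_trans (Linf_norm_lin _ _ _) _.
  by rewrite lte_add_pinfty// lte_mul_pinfty ?lee_fin ?normc_ge0.
Qed.

Lemma Linfty0 : Linfty (0 : dfun R d).
Proof.
split; last by rewrite Linf_norm0 ltry.
all: by under eq_fun do rewrite zero_ext0; exact: measurable_cst.
Qed.

Lemma Bset0 : Bset (0 : dfun R d).
Proof.
split=> j; rewrite cderivn0; first by case: cderiv0.
exact: Linfty0.
Qed.

Lemma Bset_lin (c : R[i]) f g : Bset f -> Bset g -> Bset (c *: f + g).
Proof.
move=> [sf Lf] [sg Lg]; split; first exact: smooth_lin.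
by move=> j; rewrite cderivn_lin//; exact: Linfty_lin.
Qed.

Lemma B0set0 : B0set (0 : dfun R d).
Proof.
split=> [|j]; first exact: Bset0.
by rewrite cderivn0; under eq_fun do rewrite zero_ext0; exact: cvg_cst.
Qed.

Lemma B0set_lin (c : R[i]) f g : B0set f -> B0set g -> B0set (c *: f + g).
Proof.
move=> [Bf lf] [Bg lg]; split; first exact: Bset_lin.
move=> j; rewrite cderivn_lin; [|exact: Bf.1|exact: Bg.1].
under eq_fun do rewrite zero_ext_lin.
have -> : (0 : R[i]) = c * 0 + 0 by rewrite mulr0 addr0.
by apply: cvgD => //; apply: cvgMr.
Qed.

Lemma seminorm_ge0 k f : (0 <= seminorm k f)%E.
Proof. by apply: sume_ge0 => j _; exact: Linf_norm_ge0. Qed.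

Lemma seminorm_fin k f : Bset f -> seminorm k f \is a fin_num.
Proof.
move=> [_ Lf]; rewrite ge0_fin_numE ?seminorm_ge0//.
by apply: lte_sum_pinfty => j _; case: (Lf j).
Qed.

Lemma seminorm_lin k (c : R[i]) f g : Bset f -> Bset g ->
  (seminorm k (c *: f + g)%R <=
   (Normc.normc c)%:E * seminorm k f + seminorm k g)%E.
Proof.
move=> [sf _] [sg _].
rewrite /seminorm ge0_sume_distrr; last by move=> *; exact: Linf_norm_ge0.
rewrite -big_split /=; apply: lee_sum => j _.
by rewrite cderivn_lin//; exact: Linf_norm_lin.
Qed.

Lemma fseminorm_lin k (c : R[i]) f g : Bset f -> Bset g ->
  fine (seminorm k (c *: f + g)) <=
  Normc.normc c * fine (seminorm k f) + fine (seminorm k g).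
Proof.
move=> Bf Bg; rewrite -lee_fin EFinD EFinM !fineK ?seminorm_fin//.
  exact: seminorm_lin.
exact: Bset_lin.
Qed.

Lemma fseminorm_ge0 k f : 0 <= fine (seminorm k f).
Proof. by rewrite fine_ge0// seminorm_ge0. Qed.

End SpaceTheory.

Definition Bspace (R : realType) (d : domain) : fspace R d :=
  @FSpace R d Bset (fun f => id) Bset0 Bset_lin.

Definition B0space (R : realType) (d : domain) : fspace R d :=
  @FSpace R d B0set (fun f => @proj1 _ _) B0set0 B0set_lin.

Section Nets.
Context {R : realType} {d : domain}.
Implicit Types (X : fspace R d) (u v : epsilons R -> dfun R d).

(* e |-> |u_e|_k, extended by 0 outside ]0, 1]; on B(D) the seminorms are
   finite, so fine loses nothing. *)
Definition net_seminorm (k : nat) u : R -> R :=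
  fun e => fine (seminorm k ('valL_ 0 u e)).

Definition moderate X : {pred epsilons R -> dfun R d} :=
  [pred u | `[< (forall e, X (u e)) /\
    forall k, exists m : nat,
      net_seminorm k u =O_ (0^'+) (fun e : R => e ^- m) >]].

Lemma moderateP X u : reflect ((forall e, X (u e)) /\
    forall k, exists m : nat,
      net_seminorm k u =O_ (0^'+) (fun e : R => e ^- m)) (u \in moderate X).
Proof. exact: asboolP. Qed.

Lemma valL_net X u : (forall e, X (u e)) -> forall e : R, Bset ('valL_ 0 u e).
Proof.
move=> Xu e; rewrite /valL_ /=; case: ('oinv_set_val e) => [z|] /=.
  exact: fspace_sub (Xu z).
exact: Bset0.
Qed.

Lemma net_seminorm_lin X u v k (c : R[i]) (e : R) :
  (forall e, X (u e)) -> (forall e, X (v e)) ->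
  net_seminorm k (c *: u + v) e <=
    Normc.normc c * net_seminorm k u e + net_seminorm k v e.
Proof.
move=> Xu Xv; rewrite /net_seminorm valL_lin.
by apply: fseminorm_lin; exact: valL_net.
Qed.

Lemma net_seminorm_ge0 u k e : 0 <= net_seminorm k u e.
Proof. exact: fseminorm_ge0. Qed.

Lemma bigO_le (f g h : R -> R) : (\forall e \near 0^'+, `|g e| <= `|h e|) ->
  f =O_ (0^'+) g -> f =O_ (0^'+) h.
Proof.
move=> gh /eqO_exP[A A0 HA]; apply/eqO_exP; exists A => //; near=> e.
apply: (@le_trans _ _ (A * `|g e|)); first by near: e.
by rewrite ler_pM2l//; near: e.
Unshelve. all: by end_near. Qed.

Lemma bigO_lin X u v k (c : R[i]) (h : R -> R) :
  (forall e, X (u e)) -> (forall e, X (v e)) ->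
  net_seminorm k u =O_ (0^'+) h -> net_seminorm k v =O_ (0^'+) h ->
  net_seminorm k (c *: u + v) =O_ (0^'+) h.
Proof.
move=> Xu Xv /eqO_exP[A A0 HA] /eqO_exP[B B0 HB].
apply/eqO_exP; exists (Normc.normc c * A + B).
  by rewrite ltr_wpDl// mulr_ge0 ?normc_ge0// ltW.
near=> e; rewrite ger0_norm ?net_seminorm_ge0//.
apply: le_trans (net_seminorm_lin _ _ _ Xu Xv) _.
rewrite mulrDl -mulrA lerD//.
  rewrite ler_wpM2l ?normc_ge0//.
  by apply: le_trans (ler_norm _) _; near: e.
by apply: le_trans (ler_norm _) _; near: e.
Unshelve. all: by end_near. Qed.

Lemma expNr_le (m n : nat) : (m <= n)%N ->
  \forall e \near (0 : R)^'+, `|e ^- m| <= `|e ^- n|.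
Proof.
move=> mn; near=> e.
have e0 : 0 < e by near: e; exact: nbhs_right_gt.
have e1 : e <= 1 by near: e; apply: nbhs_right_le.
have eV k : `|e ^- k| = e ^- k.
  by rewrite ger0_norm// invr_ge0 exprn_ge0// ltW.
rewrite !eV lef_pV2 ?posrE ?exprn_gt0//.
by rewrite ler_wiXn2l// ltW.
Unshelve. all: by end_near. Qed.

Lemma net_seminorm0 k : net_seminorm k (0 : epsilons R -> dfun R d) = cst 0.
Proof.
apply/funext => e; rewrite /net_seminorm.
have -> : 'valL_ 0 (0 : epsilons R -> dfun R d) e = 0.
  by rewrite /valL_ /=; case: ('oinv_set_val e).
rewrite /seminorm big1// => j _; rewrite cderivn0; exact: Linf_norm0.
Qed.

Lemma bigO_zero (h : R -> R) : (cst 0 : R -> R) =O_ (0^'+) h.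
Proof.
apply/eqO_exP; exists 1 => //; apply: nearW => e.
by rewrite normr0 mul1r.
Qed.

Lemma moderate_submod X : submod_closed (moderate X).
Proof.
split.
  apply/moderateP; split=> [e|k]; first exact: fspace0.
  by exists 0%N; rewrite net_seminorm0; exact: bigO_zero.
move=> c u v /moderateP[Xu Mu] /moderateP[Xv Mv].
apply/moderateP; split=> [e|k]; first exact: fspaceP.
have [m Hm] := Mu k; have [n Hn] := Mv k.
exists (maxn m n); apply: (bigO_lin c Xu Xv).
  by apply: bigO_le Hm; apply: expNr_le; exact: leq_maxl.
by apply: bigO_le Hn; apply: expNr_le; exact: leq_maxr.
Qed.

HB.instance Definition _ X :=
  GRing.isSubmodClosed.Build R[i] (epsilons R -> dfun R d) (moderate X)
    (moderate_submod X).

End Nets.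

Record mnet (R : realType) (d : domain) (X : fspace R d) := MNet {
  net_of :> epsilons R -> dfun R d;
  mnetP : net_of \in moderate X }.

HB.instance Definition _ R d X := [isSub for @net_of R d X].
HB.instance Definition _ R d X := [Choice of @mnet R d X by <:].
HB.instance Definition _ R d X := [SubChoice_isSubLmodule of @mnet R d X by <:].

Section Quotient.
Context {R : realType} {d : domain} (X : fspace R d).

(* Negligible nets of X are moderate (take m = 0), so N_X is stated as a
   predicate on M_X. *)
Definition negligible : {pred mnet X} :=
  [pred u | `[< forall k m : nat,
      net_seminorm k (net_of u) =O_ (0^'+) (fun e : R => e ^+ m) >]].

Lemma negligible_submod : submod_closed negligible.
Proof.
split.
  by apply/asboolP => k m; rewrite net_seminorm0; exact: bigO_zero.
move=> c u v /asboolP Nu /asboolP Nv; apply/asboolP => k m.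
have /moderateP[Xu _] := mnetP u; have /moderateP[Xv _] := mnetP v.
exact: (bigO_lin c Xu Xv (Nu k m) (Nv k m)).
Qed.

HB.instance Definition _ :=
  GRing.isSubmodClosed.Build R[i] (mnet X) negligible negligible_submod.

Definition Galg : Type := (Quotient.quot negligible).

HB.instance Definition _ := GRing.Zmodule.on Galg.
Definition Gclass (u : mnet X) : Galg := \pi_(Quotient.quot negligible) u.

Lemma Gclass_eq (u v : mnet X) : Gclass u = Gclass v <-> u - v \in negligible.
Proof.
by rewrite Quotient.idealrBE; split => [/eqP|/eqP].
Qed.

Definition Grepr (w : Galg) : mnet X := repr (w : (Quotient.quot negligible)).

Lemma GreprK w : Gclass (Grepr w) = w.
Proof. exact: reprK. Qed.

Lemma GclassD u v : Gclass (u + v) = Gclass u + Gclass v.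
Proof. exact: (raddfD (\pi_(Quotient.quot negligible))). Qed.

(* The scaling c *: [u] := [c *: u], see gscale_Gclass. *)
Definition gscale (c : R[i]) (w : Galg) : Galg := Gclass (c *: Grepr w).

Lemma gscale_Gclass c u : gscale c (Gclass u) = Gclass (c *: u).
Proof.
apply/Gclass_eq; rewrite -scalerBr; apply: rpredZ.
by apply/Gclass_eq; rewrite GreprK.
Qed.

Lemma gscaleA (c c' : R[i]) w : gscale c (gscale c' w) = gscale (c * c') w.
Proof. by rewrite -[w]GreprK !gscale_Gclass scalerA. Qed.

Lemma gscale1 : left_id 1 gscale.
Proof. by move=> w; rewrite -[w]GreprK gscale_Gclass scale1r. Qed.

Lemma gscaleDr : right_distributive gscale +%R.
Proof.
by move=> c w z; rewrite -[w]GreprK -[z]GreprK -GclassD !gscale_Gclass -GclassD scalerDr.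
Qed.

Lemma gscaleDl w : {morph gscale^~ w : c c' / c + c'}.
Proof.
by move=> c c' /=; rewrite -[w]GreprK !gscale_Gclass -GclassD scalerDl.
Qed.

HB.instance Definition _ :=
  GRing.Zmodule_isLmodule.Build R[i] Galg gscaleA gscale1 gscaleDr gscaleDl.

Lemma Gclass_lin c u v : Gclass (c *: u + v) = c *: Gclass u + Gclass v.
Proof. by rewrite GclassD -gscale_Gclass. Qed.

End Quotient.

Section Restriction.
Context {R : realType}.
Implicit Types f g : dfun R Line.

Definition restrict_fun (f : dfun R Line) : dfun R HalfLine :=
  sigL (domset R HalfLine) (zero_ext f).

Lemma zero_ext_restrict f : zero_ext (restrict_fun f) = patch (fun=> 0) (domset R HalfLine) (zero_ext f).
Proof. by rewrite -(sigLK 0). Qed.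

Lemma restrict_lin (c : R[i]) f g :
  restrict_fun (c *: f + g) = c *: restrict_fun f + restrict_fun g.
Proof. by apply/funext => x; rewrite /restrict_fun /sigL /= zero_ext_lin. Qed.

Lemma cderiv_restrict f : differentiable_on f ->
  differentiable_on (restrict_fun f) /\
  cderiv (restrict_fun f) = restrict_fun (cderiv f).
Proof.
move=> df; apply: cvg_cderiv => x.
have xR : domset R Line (val x) by [].
pose x' : domset R Line := SigSub (mem_set xR).
have zr y : domset R HalfLine y -> zero_ext (restrict_fun f) y = zero_ext f y.
  by move=> Dy; rewrite zero_ext_restrict patchE mem_set.
have -> : restrict_fun (cderiv f) x = cderiv f x'.
  exact: (valL_in 0 (cderiv f) x').
have H := @cderiv_cvg R Line f x' df.
apply: (@cvg_trans _ (diff_quot f (val x') y @[y --> within (domset R HalfLine) (val x)^'])).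
  apply: near_eq_cvg; rewrite near_withinE; apply: nearW => y Dy.
  by rewrite /diff_quot !zr//; exact: set_valP.
apply: cvg_trans H; apply: cvg_app => A HA.
move: HA; rewrite /within /= => HA.
apply: (@filterS _ (nbhs (val x)) _ _ _ _ HA) => y Hy yx _; exact: Hy.
Qed.

Lemma cderivn_restrict f j : smooth f ->
  cderivn j (restrict_fun f) = restrict_fun (cderivn j f).
Proof.
move=> sf; elim: j => // j; rewrite /cderivn /= => ->.
exact: (cderiv_restrict (sf j)).2.
Qed.

Lemma Linf_norm_restrict f : (Linf_norm (restrict_fun f) <= Linf_norm f)%E.
Proof.
rewrite !Linf_normE; apply: le_ess_sup; apply: nearW => x.
rewrite zero_ext_restrict patchE lee_fin; case: ifP => // _.
by rewrite Normc.normc0 normc_ge0.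
Qed.

Lemma Linfty_restrict f : Linfty f -> Linfty (restrict_fun f).
Proof.
move=> [mr mi fn]; split; last exact: le_lt_trans (Linf_norm_restrict f) fn.
- rewrite (_ : (fun _ => _) =
    patch (fun=> 0) (domset R HalfLine) (fun x => complex.Re (zero_ext f x))).
    apply/(measurable_restrictT _ _).1; first exact: measurable_itv.
    exact: measurable_funTS.
  by apply/funext => x; rewrite zero_ext_restrict !patchE; case: ifP.
- rewrite (_ : (fun _ => _) =
    patch (fun=> 0) (domset R HalfLine) (fun x => complex.Im (zero_ext f x))).
    apply/(measurable_restrictT _ _).1; first exact: measurable_itv.
    exact: measurable_funTS.
  by apply/funext => x; rewrite zero_ext_restrict !patchE; case: ifP.
Qed.

Lemma Bset_restrict f : Bset f -> Bset (restrict_fun f).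
Proof.
move=> [sf Lf]; split => j; rewrite cderivn_restrict//.
  by have [] := cderiv_restrict (sf j).
exact: Linfty_restrict.
Qed.

Lemma seminorm_restrict k f : Bset f ->
  fine (seminorm k (restrict_fun f)) <= fine (seminorm k f).
Proof.
move=> Bf; rewrite -lee_fin !fineK ?seminorm_fin//; last exact: Bset_restrict.
apply: lee_sum => j _; rewrite cderivn_restrict; last exact: Bf.1.
exact: Linf_norm_restrict.
Qed.

Definition restrict_net (u : epsilons R -> dfun R Line) :
  epsilons R -> dfun R HalfLine := fun e => restrict_fun (u e).

Lemma net_seminorm_restrict k u e : (forall e, Bset (u e)) ->
  net_seminorm k (restrict_net u) e <= net_seminorm k u e.
Proof.
move=> Bu; rewrite /net_seminorm /restrict_net /valL_ /=.
case: ('oinv_set_val e) => [z|] /=; first exact: seminorm_restrict.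
have -> : (0 : dfun R HalfLine) = restrict_fun 0.
  by apply/funext => x; rewrite /restrict_fun /sigL /= zero_ext0.
by apply: seminorm_restrict; exact: Bset0.
Qed.

Lemma bigO_dom (f g h : R -> R) : (forall e, 0 <= f e <= g e) ->
  g =O_ (0^'+) h -> f =O_ (0^'+) h.
Proof.
move=> fg /eqO_exP[A A0 HA]; apply/eqO_exP; exists A => //; near=> e.
have /andP[f0 fge] := fg e; rewrite ger0_norm//.
apply: le_trans fge _; apply: le_trans (ler_norm _) _; near: e.
exact: HA.
Unshelve. all: by end_near. Qed.

Lemma bigO_restrict k u (h : R -> R) : (forall e, Bset (u e)) ->
  net_seminorm k u =O_ (0^'+) h ->
  net_seminorm k (restrict_net u) =O_ (0^'+) h.
Proof.
move=> Bu; apply: bigO_dom => e; rewrite net_seminorm_ge0; exact: net_seminorm_restrict.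
Qed.

Lemma restrict_netP (u : mnet (Bspace R Line)) :
  restrict_net u \in moderate (Bspace R HalfLine).
Proof.
have /moderateP[Bu Mu] := mnetP u.
apply/moderateP; split=> [e|k]; first exact: (Bset_restrict (Bu e)).
by have [m Hm] := Mu k; exists m; exact: bigO_restrict.
Qed.

Definition restrict_mnet (u : mnet (Bspace R Line)) :
  mnet (Bspace R HalfLine) := MNet (restrict_netP u).

(* [u] |-> [u restricted to [0, +oo[], see Grestrict_class. *)
Definition Grestrict (w : Galg (Bspace R Line)) : Galg (Bspace R HalfLine) :=
  Gclass (restrict_mnet (Grepr w)).

Lemma Grestrict_class u : Grestrict (Gclass u) = Gclass (restrict_mnet u).
Proof.
apply/Gclass_eq; apply/asboolP => k m.
have /Gclass_eq/asboolP/(_ k m) := GreprK (Gclass u).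
set v := Grepr _.
have -> : net_of (restrict_mnet v - restrict_mnet u) =
          restrict_net (net_of (v - u)).
  apply/funext => e; rewrite [RHS](_ : _ = restrict_fun (v e - u e))//.
  have /esym := restrict_lin (-1) (u e) (v e).
  by rewrite !scaleN1r addrC [X in _ = restrict_fun X]addrC.
apply: bigO_restrict.
by have /moderateP[] := mnetP (v - u).
Qed.

End Restriction.

(* The canonical map G_{+,0}(D) -> G_B(D), through which the former is viewed
   as a subspace of the latter. *)
Section Embedding.
Context {R : realType} {d : domain}.

Lemma embed_netP (u : mnet (B0space R d)) : net_of u \in moderate (Bspace R d).
Proof.
have /moderateP[Bu Mu] := mnetP u.
by apply/moderateP; split=> // e; exact: fspace_sub (Bu e).
Qed.

Definition embed_mnet (u : mnet (B0space R d)) : mnet (Bspace R d) :=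
  MNet (embed_netP u).

Definition Gembed (w : Galg (B0space R d)) : Galg (Bspace R d) :=
  Gclass (embed_mnet (Grepr w)).

Lemma embed_class_eq u v :
  Gclass (embed_mnet u) = Gclass (embed_mnet v) <-> Gclass u = Gclass v.
Proof. by split=> /Gclass_eq/asboolP H; apply/Gclass_eq/asboolP. Qed.

Lemma Gembed_class u : Gembed (Gclass u) = Gclass (embed_mnet u).
Proof. by apply/embed_class_eq; exact: GreprK. Qed.

Lemma Gembed_inj : injective Gembed.
Proof. by move=> w z /embed_class_eq; rewrite !GreprK. Qed.

End Embedding.

Definition seeley_term (R : realType) (a b : R^nat) (u : dfun R HalfLine)
    (x : R) : R[i]^nat :=
  fun l => (a l)%:C * zero_ext u (b l * x).

Definition seeley_ext (R : realType) (a b : R^nat) (u : dfun R HalfLine) :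
    dfun R Line :=
  fun x => if 0 <= val x then zero_ext u (val x)
           else limn (series (seeley_term a b u (val x))).

(* T sends the class of (u_e), whichever representative is taken, to the class of
   (F u_e), which is a moderate net of Y. *)
Definition induced_by (R : realType) (d d' : domain) (X : fspace R d)
    (Y : fspace R d') (F : dfun R d -> dfun R d') (T : Galg X -> Galg Y) :
    Prop :=
  forall u : mnet X, exists v : mnet Y,
    (forall e, v e = F (u e)) /\ T (Gclass u) = Gclass v.

(* Main.v *)
Require Import Defs.
From HB Require Import structures.
From mathcomp Require Import all_boot all_order all_algebra complex.
From mathcomp Require Import all_classical all_reals all_analysis.
From mathcomp Require Import ess_sup_inf measurable_realfun.
From mathcomp Require Import ring lra.
Import Order.TTheory GRing.Theory Num.Theory.
Import numFieldNormedType.Exports.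
Local Open Scope classical_set_scope.
Local Open Scope ring_scope.
Local Open Scope complex_scope.

(* For x <= 0 the extension is the series sum_l a_l u(b_l x), also at x = 0 since
   sum_l a_l = 1. Because u'' is bounded, a first-order Taylor bound for u on the
   half-line can be summed against |a_l| b_l^2, which shows that this series is
   differentiable on the closed left half-line with derivative
   sum_l a_l b_l u'(b_l x). The sequences (a_l b_l) and (b_l) satisfy the same
   moment conditions, so by induction the j-th derivative of Eu is the extension of
   u^(j) with coefficients a_l b_l^j; hence
   ||(Eu)^(j)|| <= (1 + sum_l |a_l| |b_l|^j) ||u^(j)||, and E preserves moderate
   and negligible nets. *)

Import Normc.

(** * Modulus, limits and dominated series in [R[i]] *)

Lemma normCE {R : realType} (z : R[i]) : `|z| = (normc z)%:C.
Proof. by []. Qed.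

Lemma normcR {R : realType} (x : R) : normc x%:C = `|x|.
Proof. by rewrite /normc /= expr0n /= addr0 sqrtr_sqr. Qed.

Lemma normcB {R : realType} (z w : R[i]) : normc (z - w) = normc (w - z).
Proof. by rewrite -normcN opprB. Qed.

Lemma complexReB {R : realType} (z w : R[i]) :
  complex.Re (z - w) = complex.Re z - complex.Re w.
Proof. by case: z w => ? ? []. Qed.

Lemma complexRe_realM {R : realType} (r : R) (z : R[i]) :
  complex.Re (r%:C * z) = r * complex.Re z.
Proof. by case: z => ? ? /=; rewrite mul0r subr0. Qed.

Lemma ler_Re_normc {R : realType} (z : R[i]) : `|complex.Re z| <= normc z.
Proof. by have := normc_ge_Re z; rewrite normCE lecR. Qed.

Lemma ler_Im_normc {R : realType} (z : R[i]) : `|complex.Im z| <= normc z.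
Proof.
case: z => x y /=; rewrite -sqrtr_sqr ler_wsqrtr// lerDr; exact: sqr_ge0.
Qed.

Lemma normc_le_ReIm {R : realType} (z : R[i]) :
  normc z <= `|complex.Re z| + `|complex.Im z|.
Proof.
case: z => x y /=; rewrite -[leRHS]ger0_norm ?addr_ge0// -sqrtr_sqr ler_wsqrtr//.
rewrite sqrrD !real_normK ?num_real//= -addrA lerD2l lerDr.
by rewrite mulrn_wge0// mulr_ge0.
Qed.

(** The norm of [R[i]] takes its values in [R[i]] itself, where a positive element is real; real
    tolerances are therefore enough. *)
Lemma cvgc_normcP {R : realType} {T : Type} {F : set_system T} {FF : Filter F}
    (f : T -> R[i]) (l : R[i]) :
  f x @[x --> F] --> l <->
  forall e : R, 0 < e -> \forall x \near F, normc (l - f x) < e.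
Proof.
split=> [/cvgrPdist_lt fl e e0|fl].
  have := fl e%:C; rewrite ltcR => /(_ e0); apply: filterS => x.
  by rewrite normCE ltcR.
apply/cvgrPdist_lt => e e0; have eE := RRe_real (gtr0_real e0).
move: e0; rewrite -eE ltcR => e0; have := fl _ e0; apply: filterS => x.
by rewrite normCE ltcR.
Qed.

Lemma cvg_Re {R : realType} {T : Type} {F : set_system T} {FF : Filter F}
    {f : T -> R[i]} {l : R[i]} :
  f x @[x --> F] --> l -> complex.Re (f x) @[x --> F] --> complex.Re l.
Proof.
move=> /cvgc_normcP fl; apply/cvgrPdist_lt => e /fl; apply: filterS => x.
by apply: le_lt_trans; rewrite -raddfB; exact: ler_Re_normc.
Qed.

Lemma cvg_Im {R : realType} {T : Type} {F : set_system T} {FF : Filter F}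
    {f : T -> R[i]} {l : R[i]} :
  f x @[x --> F] --> l -> complex.Im (f x) @[x --> F] --> complex.Im l.
Proof.
move=> /cvgc_normcP fl; apply/cvgrPdist_lt => e /fl; apply: filterS => x.
by apply: le_lt_trans; rewrite -raddfB; exact: ler_Im_normc.
Qed.

Lemma cvg_ReIm {R : realType} {T : Type} {F : set_system T} {FF : Filter F}
    {f : T -> R[i]} {l : R[i]} :
  complex.Re (f x) @[x --> F] --> complex.Re l ->
  complex.Im (f x) @[x --> F] --> complex.Im l ->
  f x @[x --> F] --> l.
Proof.
move=> /cvgrPdist_lt fr /cvgrPdist_lt fi; apply/cvgc_normcP => e e0.
have e2 : 0 < e / 2 by rewrite divr_gt0.
near=> x; apply: le_lt_trans (normc_le_ReIm _) _.
rewrite [e]splitr ltrD// raddfB; near: x; [exact: fr | exact: fi].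
Unshelve. all: by end_near. Qed.

(** Real and imaginary parts are dominated by [c], so both series converge absolutely in [R]. The
    bound holds for partial sums and passes to the limit. *)
Lemma series_normc_le {R : realType} {z : R[i]^nat} {c : R^nat} :
  (forall l, normc (z l) <= c l) -> cvgn (series c) ->
  cvgn (series z) /\ normc (limn (series z)) <= limn (series c).
Proof.
move=> zc cc.
(* One argument serves both components: [p] stands for [complex.Re] and then for [complex.Im]. *)
have part (p : R[i] -> R) : {morph p : x y / x + y} -> p 0 = 0 ->
    (forall w, `|p w| <= normc w) -> cvgn (fun n => p (series z n)).
  move=> pD p0 pn.
  have -> : (fun n => p (series z n)) = series (p \o z).
    by apply/funext => n; rewrite /series /= (big_morph p pD p0).
  apply: normed_cvg; apply: (series_le_cvg _ _ _ cc) => l //=.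
    by apply: le_trans (zc l); exact: normc_ge0.
  exact: le_trans (zc l).
have cR := part (@complex.Re R) (raddfD _) erefl ler_Re_normc.
have cI := part (@complex.Im R) (raddfD _) erefl ler_Im_normc.
pose s : R[i] := limn (fun n => complex.Re (series z n)) +i*
                 limn (fun n => complex.Im (series z n)).
have zs : series z @ \oo --> s by exact: cvg_ReIm.
split; first by apply/cvg_ex; exists s.
have -> : limn (series z) = s by exact: (cvg_lim (@norm_hausdorff _ _)).
have bnd n : normc (series z n) <= limn (series c).
  apply: (@le_trans _ _ (series c n)).
    rewrite /series /=; elim/big_ind2 : _ => //; first by rewrite normc0.
    by move=> x1 x2 y1 y2 h1 h2; apply: le_trans (normcD _ _) _; exact: lerD.
  apply: nondecreasing_cvgn_le => //; apply: nondecreasing_series => l _ _.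
  by apply: le_trans (zc l); exact: normc_ge0.
apply/ler_addgt0Pr => e e0.
have /cvgc_normcP/(_ e e0) [N _ /(_ N (leqnn N)) sN] := zs.
rewrite -[s](subrK (series z N)) addrC.
by apply: le_trans (normcD _ _) _; rewrite lerD// ltW.
Qed.

Lemma cvgcD {R : realType} {T : Type} {F : set_system T} {FF : Filter F}
    {f g : T -> R[i]} {k l : R[i]} :
  f x @[x --> F] --> k -> g x @[x --> F] --> l ->
  f x + g x @[x --> F] --> k + l.
Proof.
move=> fk gl; apply: cvg_ReIm; rewrite raddfD.
  under eq_fun do rewrite raddfD.
  by apply: cvgD; exact: cvg_Re.
under eq_fun do rewrite raddfD.
by apply: cvgD; exact: cvg_Im.
Qed.

Lemma cvgcM {R : realType} {T : Type} {F : set_system T} {FF : Filter F}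
    {f g : T -> R[i]} {k l : R[i]} :
  f x @[x --> F] --> k -> g x @[x --> F] --> l ->
  f x * g x @[x --> F] --> k * l.
Proof.
have ReM (z w : R[i]) : complex.Re (z * w) =
    complex.Re z * complex.Re w - complex.Im z * complex.Im w.
  by case: z w => ? ? [].
have ImM (z w : R[i]) : complex.Im (z * w) =
    complex.Re z * complex.Im w + complex.Im z * complex.Re w.
  by case: z w => ? ? [].
move=> fk gl; apply: cvg_ReIm; [rewrite ReM|rewrite ImM].
  under eq_fun do rewrite ReM.
  by apply: cvgB; apply: cvgM; (apply: cvg_Re || apply: cvg_Im).
under eq_fun do rewrite ImM.
by apply: cvgD; apply: cvgM; (apply: cvg_Re || apply: cvg_Im).
Qed.

(** * Difference quotients and continuity on the line and the half-line *)

Lemma zero_ext_cderiv_cvg {R : realType} {d : domain} {f : dfun R d} {x : R} :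
  domset R d x -> differentiable_on f ->
  diff_quot f x y @[y --> within (domset R d) x^'] --> zero_ext (cderiv f) x.
Proof.
move=> Dx df; pose x' : domset R d := SigSub (mem_set Dx).
have -> : zero_ext (cderiv f) x = cderiv f x' by exact: (valL_in 0 _ x').
exact: (@cderiv_cvg _ _ f x').
Qed.

(** Both domains are closed upwards, so a right neighbourhood of a point of the domain stays inside
    it, even at the boundary point 0. *)
Lemma at_right_domset {R : realType} {d : domain} {x : R} : domset R d x ->
  x^'+ `=>` within (domset R d) x^'.
Proof.
move=> Dx A; rewrite /within /dnbhs /at_right /within /= => H.
apply: (@filterS _ (nbhs x) _ _ _ _ H) => y {}H xy; apply: H; first by rewrite gt_eqF.
exact: domset_right xy.
Qed.

Lemma dnbhs_domset {R : realType} {d : domain} {x : R} :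
  (\forall y \near x, domset R d y) -> x^' `=>` within (domset R d) x^'.
Proof.
move=> Dx A; rewrite /dnbhs /within /= => H.
by apply: (@filterS2 _ (nbhs x) _ _ _ _ _ Dx H) => y Dy {}H yx; exact: H.
Qed.

Lemma near_domset_gt0 {R : realType} {d : domain} {x : R} : 0 < x ->
  \forall y \near x, domset R d y.
Proof.
move=> x0; case: d; first exact: (@nearW _ (nbhs x) _).
have : \forall y \near x, 0 < y by exact: lt_nbhsr.
by apply: filterS => y /ltW y0; rewrite /= in_itv /= y0.
Qed.

(** Differentiability gives continuity: f(y) is the difference quotient times y - x, plus f(x), and
    the first term tends to 0. *)
Lemma cvg_zero_ext {R : realType} {d : domain} {f : dfun R d} {x : R} :
  domset R d x -> differentiable_on f ->
  zero_ext f y @[y --> within (domset R d) x^'] --> zero_ext f x.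
Proof.
move=> Dx df; have dq := zero_ext_cderiv_cvg Dx df.
have FF : ProperFilter (within (domset R d) x^').
  exact: (domset_filter (SigSub (mem_set Dx))).
have yx : (y - x)%:C @[y --> within (domset R d) x^'] --> (0 : R[i]).
  have xF : y @[y --> within (domset R d) x^'] --> x.
    exact: cvg_trans (cvg_within _) (cvg_within _).
  apply/cvgc_normcP => e e0; move/cvgrPdist_lt : xF => /(_ e e0).
  by apply: filterS => y; rewrite sub0r normcN normcR distrC.
have : diff_quot f x y * (y - x)%:C + zero_ext f x
    @[y --> within (domset R d) x^'] --> zero_ext (cderiv f) x * 0 + zero_ext f x.
  exact: (cvgcD (cvgcM dq yx) (cvg_cst _)).
rewrite mulr0 add0r; apply: cvg_trans; apply: near_eq_cvg.
rewrite near_withinE near_withinE; apply: nearW => y yx' _.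
by rewrite /diff_quot divfK ?subrK// fmorph_eq0 subr_eq0.
Qed.

(** Passage to real calculus. The point is interior because [is_derive] is two-sided; the factor [c]
    admits a phase, or -i to reach the imaginary part. *)
Lemma is_derive_Re {R : realType} {d : domain} {f : dfun R d} (c : R[i]) {x : R} :
  (\forall y \near x, domset R d y) -> differentiable_on f ->
  is_derive x (1 : R) (fun y => complex.Re (c * zero_ext f y))
            (complex.Re (c * zero_ext (cderiv f) x)).
Proof.
move=> Dx df.
have dq : diff_quot f x y @[y --> x^'] --> zero_ext (cderiv f) x.
  apply: cvg_trans (zero_ext_cderiv_cvg (nbhs_singleton Dx) df).
  exact: cvg_app (dnbhs_domset Dx).
have {}dq : complex.Re (c * diff_quot f x y) @[y --> x^'] -->
    complex.Re (c * zero_ext (cderiv f) x).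
  exact: (cvg_Re (cvgcM (cvg_cst c) dq)).
have H : h^-1 *: (complex.Re (c * zero_ext f (h *: (1 : R) + x)) -
                  complex.Re (c * zero_ext f x))
    @[h --> 0^'] --> complex.Re (c * zero_ext (cderiv f) x).
  apply/cvgrPdist_lt => e e0; move/cvgrPdist_lt : dq => /(_ e e0).
  rewrite !near_withinE => /nbhs0P; apply: filterS => h H h0.
  have := H; rewrite -subr_eq0 addrAC subrr add0r => /(_ h0).
  congr (`|_ - _| < e).
  rewrite /diff_quot [x + h]addrC addrK -fmorphV mulrA [h *: 1](mulr1 h).
  rewrite -raddfB -mulrBr; case: (c * _) => p q /=.
  by rewrite mulr0 subr0 mulrC.
apply: DeriveDef; first by apply/cvg_ex; eexists; exact: H.
by apply: cvg_lim; [exact: norm_hausdorff | exact: H].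
Qed.

(** * Mean value and Taylor estimates, and pointwise bounds from the essential supremum *)

Lemma exists_phase {R : realType} (z : R[i]) :
  exists2 c : R[i], normc c <= 1 & complex.Re (c * z) = normc z.
Proof.
(* For [z = 0] the quotient is 0, since the inverse of 0 is 0; hence an inequality for the modulus
   of [c]. *)
exists (z^* / (normc z)%:C).
  rewrite normcM normcV normcR (ger0_norm (normc_ge0 z)).
  have -> : normc z^* = normc z by case: z => x y /=; rewrite sqrrN.
  by have [->|z0] := eqVneq (normc z) 0; [rewrite mul0r | rewrite divff].
have [z0|z0] := eqVneq (normc z) 0; first by rewrite z0 (eq0_normc z0) mulr0.
have E : z^* * z = ((normc z) ^+ 2)%:C.
  case: z {z0} => x y; rewrite /= sqr_sqrtr ?addr_ge0 ?sqr_ge0//.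
  by congr (_ +i* _); rewrite ?expr2; ring.
rewrite mulrAC E -fmorphV -rmorphM /= expr2 mulfK//.
Qed.

Lemma domset_half {R : realType} (x : R) : domset R HalfLine x = (0 <= x) :> Prop.
Proof. by rewrite /= in_itv /= andbT. Qed.

(** The mean value equality fails for complex values. A phase [c] turns the modulus of the increment
    into a real part, and the real mean value theorem applies to Re(c f). Both [w = 0] (Lipschitz
    bound) and w = f'(x) (Taylor bound) are needed later. *)
Lemma mean_value_ineq {R : realType} {f : dfun R HalfLine} {w : R[i]} {K s t : R} :
  differentiable_on f -> 0 <= s -> s <= t ->
  (forall y, s <= y <= t -> normc (zero_ext (cderiv f) y - w) <= K) ->
  normc (zero_ext f t - zero_ext f s - (t - s)%:C * w) <= K * (t - s).
Proof.
move=> df s0 st fK; move: st; rewrite le_eqVlt => /predU1P[<-|st].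
  by rewrite !subrr mul0r subr0 normc0 mulr0.
set z := (X in normc X); have [c c1 <-] := exists_phase z.
have int (y : R) : 0 < y -> \forall y' \near y, domset R HalfLine y'.
  exact: near_domset_gt0.
have Ds : domset R HalfLine s by rewrite domset_half.
have t0 : 0 < t by exact: le_lt_trans st.
pose g y := complex.Re (c * zero_ext f y).
have gcvg (F : set_system R) y : Filter F -> zero_ext f y' @[y' --> F] --> zero_ext f y ->
    g y' @[y' --> F] --> g y.
  by move=> FF fy; exact: (cvg_Re (cvgcM (cvg_cst c) fy)).
have [y yst] : exists2 y, y \in `]s, t[ &
    g t - g s = complex.Re (c * zero_ext (cderiv f) y) * (t - s).
  apply: (@MVT R g (fun y => complex.Re (c * zero_ext (cderiv f) y))) => //.
    move=> y /itvP yst; apply: is_derive_Re => //; apply: int.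
    by apply: le_lt_trans s0 _; rewrite yst.
  apply/continuous_within_itvP => //; split.
  - move=> y /itvP yst.
    have Dy : \forall y' \near y, domset R HalfLine y'.
      by apply: int; apply: le_lt_trans s0 _; rewrite yst.
    have [dg _] := is_derive_Re c Dy df.
    by apply: differentiable_continuous; exact/derivable1_diffP.
  (* The left endpoint may be 0, where only continuity from the right is available. *)
  - apply: gcvg; apply: cvg_trans (cvg_zero_ext Ds df).
    exact: cvg_app (at_right_domset Ds).
  - have := int t t0 => Dt; apply: gcvg.
    apply: cvg_trans (cvg_zero_ext (nbhs_singleton Dt) df).
    apply: cvg_app; apply: cvg_trans (dnbhs_domset Dt).
    by apply: within_subset => y yt; rewrite lt_eqF.
move=> gE; have -> : complex.Re (c * z) =
    complex.Re (c * (zero_ext (cderiv f) y - w)) * (t - s).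
  have -> : c * (zero_ext (cderiv f) y - w) = c * zero_ext (cderiv f) y - c * w.
    exact: mulrBr.
  have -> : c * z = c * zero_ext f t - c * zero_ext f s - (t - s)%:C * (c * w).
    by rewrite /z; ring.
  by rewrite !complexReB complexRe_realM -/(g t) -/(g s) gE; ring.
rewrite ler_wpM2r ?subr_ge0 ?(ltW st)//.
apply: le_trans (ler_norm _) _; apply: le_trans (ler_Re_normc _) _.
rewrite normcM; apply: le_trans (fK y _); last by rewrite !(itvP yst).
by rewrite ler_piMl// normc_ge0.
Qed.

(** The bound on f'' makes f' Lipschitz with constant [M], so f' differs from f'(x) by at most M |y
    - x| between x and y. The mean value inequality then supplies the second factor |y - x|; the
    sharper M/2 is not sought. *)
Lemma taylor1_le {R : realType} {f : dfun R HalfLine} {M x y : R} :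
  differentiable_on f -> differentiable_on (cderiv f) ->
  (forall z, 0 <= z -> normc (zero_ext (cderiv (cderiv f)) z) <= M) ->
  0 <= x -> 0 <= y ->
  normc (zero_ext f y - zero_ext f x - (y - x)%:C * zero_ext (cderiv f) x)
    <= M * (y - x) ^+ 2.
Proof.
move=> df ddf fM x0 y0.
have M0 : 0 <= M by exact: le_trans (normc_ge0 _) (fM 0 (lexx 0)).
have lip s t : 0 <= s -> s <= t ->
    normc (zero_ext (cderiv f) t - zero_ext (cderiv f) s) <= M * (t - s).
  move=> s0 st; have := @mean_value_ineq _ _ 0 M _ _ ddf s0 st.
  rewrite mulr0 subr0; apply=> z /andP[sz _]; rewrite subr0; apply: fM.
  exact: le_trans sz.
have [xy|yx] := leP x y.
  rewrite expr2 mulrA; apply: mean_value_ineq => // z /andP[xz zy].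
  by apply: le_trans (lip _ _ x0 xz) _; rewrite ler_wpM2l// lerD2r.
(* For y < x the roles of the endpoints are exchanged, while the derivative is still compared with
   its value at x. *)
have -> : zero_ext f y - zero_ext f x - (y - x)%:C * zero_ext (cderiv f) x =
   - (zero_ext f x - zero_ext f y - (x - y)%:C * zero_ext (cderiv f) x).
  by rewrite !rmorphB /=; ring.
rewrite normcN -sqrrN opprB expr2 mulrA.
apply: mean_value_ineq => //; first exact: ltW.
move=> z /andP[yz zx]; rewrite normcB.
apply: le_trans (lip _ _ (le_trans y0 yz) zx) _; rewrite ler_wpM2l//.
by rewrite lerD2l lerN2.
Qed.

(** If the value at [x] exceeded the essential supremum, continuity from the right would keep it
    above on an interval ]x, x + e[, whose measure is positive. *)
Lemma normc_le_Linf {R : realType} {d : domain} {f : dfun R d} (x : R) :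
  differentiable_on f -> Linf_norm f \is a fin_num ->
  normc (zero_ext f x) <= fine (Linf_norm f).
Proof.
move=> df ffin; rewrite leNgt; apply/negP => Mx.
have Dx : domset R d x.
  apply: contrapT => nDx; move: Mx; rewrite /zero_ext (valL_out _ _ nDx) normc0.
  by rewrite ltNge fine_ge0// Linf_norm_ge0.
have [e e0 xe] : exists2 e, 0 < e &
    forall y, x < y < x + e -> fine (Linf_norm f) < normc (zero_ext f y).
  have fx : zero_ext f y @[y --> x^'+] --> zero_ext f x.
    apply: cvg_trans (cvg_zero_ext Dx df).
    exact: cvg_app (at_right_domset Dx).
  have e0 : 0 < normc (zero_ext f x) - fine (Linf_norm f) by rewrite subr_gt0.
  have /cvgc_normcP/(_ _ e0) [e /= e1 H] := fx.
  exists e => // y /andP[xy ye]; have := H y.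
  rewrite /= ltr_norml => H'.
  have {}H' : normc (zero_ext f x - zero_ext f y) <
      normc (zero_ext f x) - fine (Linf_norm f).
    by apply: H' => //; apply/andP; split; lra.
  have := normcD (zero_ext f x - zero_ext f y) (zero_ext f y).
  by rewrite subrK; lra.
have [A [mA A0 sub]] := ess_sup_ge lebesgue_measure
  (fun y : R => (normc (zero_ext f y))%:E).
have : (lebesgue_measure (`]x, (x + e)%R[ : set R) <= lebesgue_measure A)%E.
  apply: le_measure; rewrite ?inE//.
  move=> y /=; rewrite in_itv /= => /xe ye; apply: sub => /=.
  rewrite -Linf_normE -(fineK ffin) lee_fin => H.
  by move: ye; rewrite ltNge H.
rewrite A0 lebesgue_measure_itv /= lte_fin ltrDl e0 -EFinB lee_fin.
by rewrite addrC addKr leNgt e0.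
Qed.

(** * Seeley sequences and the series [seeley_sum] *)

Lemma lim_series_linear {R : realType} (c : R[i]) {f g : R[i]^nat} :
  cvgn (series f) -> cvgn (series g) ->
  cvgn (series (fun l => c * f l + g l)) /\
  limn (series (fun l => c * f l + g l)) = c * limn (series f) + limn (series g).
Proof.
move=> cf cg.
have sE : series (fun l => c * f l + g l) = (fun n => c * series f n + series g n).
  by apply/funext => n; rewrite /series /= big_split mulr_sumr.
have H : series (fun l => c * f l + g l) @ \oo -->
    c * limn (series f) + limn (series g).
  rewrite sE; exact: (cvgcD (cvgcM (cvg_cst c) cf) cg).
split; first by apply/cvg_ex; eexists; exact: H.
exact: (cvg_lim (@norm_hausdorff _ _)).
Qed.

Definition seeley_seq {R : realType} (a b : R^nat) : Prop :=
  [/\ forall l, b l < 0,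
      forall n, cvgn (series (fun l => `|a l| * `|b l| ^+ n)) &
      forall n, series (fun l => a l * b l ^+ n) @ \oo --> (1 : R)].

(* Differentiating under the sum multiplies a_l by b_l, and the moment conditions
   are stable under this operation. *)
Lemma seeley_seqM {R : realType} {a b : R^nat} (j : nat) :
  seeley_seq a b -> seeley_seq (fun l => a l * b l ^+ j) b.
Proof.
move=> [b0 ab ab1]; split=> // n.
  under eq_fun do rewrite normrM normrX -mulrA -exprD.
  exact: ab.
under eq_fun do rewrite -mulrA -exprD.
exact: ab1.
Qed.

Definition total_mass {R : realType} (a : R^nat) : R :=
  limn (series (fun l => `|a l|)).

Lemma seeley_seq_summable {R : realType} {a b : R^nat} :
  seeley_seq a b -> cvgn (series (fun l => `|a l|)).
Proof.
move=> [_ /(_ 0%N) H _].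
rewrite (_ : (fun l => _) = (fun l => `|a l| * `|b l| ^+ 0))//.
by apply/funext => l; rewrite expr0 mulr1.
Qed.

Lemma total_mass_ge0 {R : realType} {a b : R^nat} :
  seeley_seq a b -> 0 <= total_mass a.
Proof.
move=> /seeley_seq_summable ca; apply: limr_ge => //.
by apply: nearW => n; rewrite /series /= sumr_ge0.
Qed.

Definition seeley_sum {R : realType} (a b : R^nat) (u : dfun R HalfLine) (x : R) :
  R[i] := limn (series (seeley_term a b u x)).

Lemma series_mass_le {R : realType} {a b : R^nat} {K : R} {z : R[i]^nat} :
  seeley_seq a b -> (forall l, normc (z l) <= `|a l| * K) ->
  cvgn (series z) /\ normc (limn (series z)) <= total_mass a * K.
Proof.
move=> ab zK; have ca := seeley_seq_summable ab.
have aK : series (fun l => `|a l| * K) @ \oo --> total_mass a * K.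
  rewrite (_ : series _ = (fun n => series (fun l => `|a l|) n * K)).
    by apply: cvgM ca (cvg_cst _).
  by apply/funext => n; rewrite /series /= mulr_suml.
have [cz zn] := series_normc_le zK (cvgP _ aK).
by split=> //; apply: le_trans zn _; rewrite (cvg_lim _ aK).
Qed.

Lemma seeley_sum_cvg {R : realType} {a b : R^nat} {u : dfun R HalfLine} {M : R} x :
  seeley_seq a b -> (forall y, normc (zero_ext u y) <= M) ->
  cvgn (series (seeley_term a b u x)) /\
  normc (seeley_sum a b u x) <= total_mass a * M.
Proof.
move=> ab uM; apply: (series_mass_le ab) => l.
by rewrite /seeley_term normcM normcR ler_wpM2l.
Qed.

(** At 0 every term is a_l u(0), and the moment of order 0 is 1. This glues the two branches of the
    extension continuously. *)
Lemma seeley_sum0 {R : realType} {a b : R^nat} {u : dfun R HalfLine} :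
  seeley_seq a b -> seeley_sum a b u 0 = zero_ext u 0.
Proof.
move=> [_ _ /(_ 0%N) a1]; apply: (cvg_lim (@norm_hausdorff _ _)).
have -> : series (seeley_term a b u 0) =
    (fun n => (series (fun l => a l * b l ^+ 0) n)%:C * zero_ext u 0).
  apply/funext => n; rewrite /series /= rmorph_sum mulr_suml.
  by apply: eq_bigr => l _; rewrite /seeley_term mulr0 expr0 mulr1.
rewrite -[X in _ --> X]mul1r; apply: cvgcM; last exact: cvg_cst.
apply/cvgc_normcP => e e0; move/cvgrPdist_lt : a1 => /(_ e e0).
apply: filterS => n; rewrite -(rmorph1 (real_complex R)) -rmorphB normcR.
exact.
Qed.

Lemma zero_ext_seeley {R : realType} (a b : R^nat) (u : dfun R HalfLine) (x : R) :
  zero_ext (seeley_ext a b u) x =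
    if 0 <= x then zero_ext u x else seeley_sum a b u x.
Proof.
pose x' : domset R Line := SigSub (mem_set (I : domset R Line x)).
exact: (valL_in 0 (seeley_ext a b u) x').
Qed.

Lemma zero_ext_seeley_le0 {R : realType} {a b : R^nat} {u : dfun R HalfLine} {x : R} :
  seeley_seq a b -> x <= 0 ->
  zero_ext (seeley_ext a b u) x = seeley_sum a b u x.
Proof.
move=> ab x0; rewrite zero_ext_seeley; case: ifPn => // x0'.
have -> : x = 0 by apply/eqP; rewrite eq_le x0 x0'.
by rewrite seeley_sum0.
Qed.

(** Taylor bounds for u between b_l x and b_l y are summed: both points are nonnegative since b_l <
    0, and the remainder M2 b_l^2 (y - x)^2 is summable against |a_l|. *)
Lemma seeley_sum_taylor {R : realType} {a b : R^nat} {u : dfun R HalfLine}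
    {M0 M1 M2 x y : R} :
  seeley_seq a b -> differentiable_on u -> differentiable_on (cderiv u) ->
  (forall z, normc (zero_ext u z) <= M0) ->
  (forall z, normc (zero_ext (cderiv u) z) <= M1) ->
  (forall z, normc (zero_ext (cderiv (cderiv u)) z) <= M2) ->
  x <= 0 -> y <= 0 ->
  normc (seeley_sum a b u y - seeley_sum a b u x -
         (y - x)%:C * seeley_sum (fun l => a l * b l) b (cderiv u) x) <=
    total_mass (fun l => a l * b l ^+ 2) * (M2 * (y - x) ^+ 2).
Proof.
move=> ab du ddu uM0 uM1 uM2 x0 y0.
have ab1 : seeley_seq (fun l => a l * b l) b by have := seeley_seqM 1 ab.
have cx := (seeley_sum_cvg x ab uM0).1.
have cy := (seeley_sum_cvg y ab uM0).1.
have cdx := (seeley_sum_cvg x ab1 uM1).1.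
(* The coefficients -1 and -(y - x) merge three convergent series into one, whose l-th term is a_l
   times the Taylor remainder [D]. *)
have [c1 l1] := lim_series_linear (-1) cx cy.
have [c2 l2] := lim_series_linear (- (y - x)%:C) cdx c1.
rewrite /seeley_sum [X in normc X](_ : _ = limn (series (fun l =>
    - (y - x)%:C * seeley_term (fun l => a l * b l) b (cderiv u) x l
    + (-1 * seeley_term a b u x l + seeley_term a b u y l)))); last first.
  by rewrite l2 l1; ring.
apply: (series_mass_le (seeley_seqM 2 ab) _).2 => l.
have b0 : b l < 0 by case: ab.
set D := zero_ext u (b l * y) - zero_ext u (b l * x) -
  (b l * y - b l * x)%:C * zero_ext (cderiv u) (b l * x).
have -> : - (y - x)%:C * seeley_term (fun l => a l * b l) b (cderiv u) x l
    + (-1 * seeley_term a b u x l + seeley_term a b u y l) = (a l)%:C * D.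
  by rewrite /D /seeley_term !(rmorphB, rmorphM) /=; ring.
have D_le : normc D <= M2 * (b l * y - b l * x) ^+ 2.
  by apply: taylor1_le => //; rewrite nmulr_rge0.
rewrite normcM normcR normrM -mulrA ler_wpM2l//.
apply: le_trans D_le _; rewrite -mulrBr exprMn normrX real_normK ?num_real//.
by rewrite mulrCA.
Qed.

(** * Derivatives of the extension, of every order *)

Lemma Bset_bound {R : realType} {d : domain} {u : dfun R d} (j : nat) (x : R) :
  Bset u -> normc (zero_ext (cderivn j u) x) <= fine (Linf_norm (cderivn j u)).
Proof.
move=> [su Lu]; apply: normc_le_Linf; first exact: su.
by rewrite ge0_fin_numE ?Linf_norm_ge0//; case: (Lu j).
Qed.

Lemma diff_quot_cvg_quadratic {R : realType} {d : domain} {f : dfun R d} {C x : R}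
    {l : R[i]} {F : set_system R} {FF : Filter F} :
  0 <= C -> y @[y --> F] --> x ->
  (\forall y \near F, y != x /\
    normc (zero_ext f y - zero_ext f x - (y - x)%:C * l) <= C * (y - x) ^+ 2) ->
  diff_quot f x y @[y --> F] --> l.
Proof.
move=> C0 Fx H; apply/cvgc_normcP => e e0.
(* The quotient errs by at most C |y - x|; dividing by C + 1 covers the case C = 0. *)
have Ce : 0 < e / (C + 1) by rewrite divr_gt0// ltr_wpDl.
move/cvgrPdist_lt : Fx => /(_ _ Ce); apply: filterS2 H => y [yx H] xy.
have dyx : 0 < `|y - x| by rewrite normr_gt0 subr_eq0.
have zyx : (y - x)%:C != 0 by rewrite fmorph_eq0 subr_eq0.
have -> : l - diff_quot f x y =
    - ((zero_ext f y - zero_ext f x - (y - x)%:C * l) / (y - x)%:C).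
  by rewrite /diff_quot [in RHS]mulrBl [_%:C * l]mulrC mulfK// opprB.
rewrite normcN normcM normcV normcR ltr_pdivrMr//.
apply: le_lt_trans H _; rewrite -real_normK ?num_real// expr2 mulrA ltr_pM2r//.
rewrite distrC in xy.
have : (C + 1) * `|y - x| < e by rewrite mulrC -ltr_pdivlMr// ltr_wpDl.
by apply: le_lt_trans; rewrite ler_wpM2r ?lerDl.
Qed.

Lemma cvg_left_right {R : realType} {T : topologicalType} {f : R -> T} {x : R} {l : T} :
  f y @[y --> x^'+] --> l -> f y @[y --> x^'-] --> l -> f y @[y --> x^'] --> l.
Proof.
move=> fr fl A Al.
have r : \forall y \near x, x < y -> A (f y) by have := fr A Al.
have s : \forall y \near x, y < x -> A (f y) by have := fl A Al.
suff : \forall y \near x, y != x -> A (f y) by [].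
by apply: filterS2 r s => y r s; rewrite neq_lt => /orP[/s|/r].
Qed.

Lemma cderiv_seeley {R : realType} {a b : R^nat} {u : dfun R HalfLine}
    {M0 M1 M2 : R} :
  seeley_seq a b -> differentiable_on u -> differentiable_on (cderiv u) ->
  (forall z, normc (zero_ext u z) <= M0) ->
  (forall z, normc (zero_ext (cderiv u) z) <= M1) ->
  (forall z, normc (zero_ext (cderiv (cderiv u)) z) <= M2) ->
  differentiable_on (seeley_ext a b u) /\
  cderiv (seeley_ext a b u) = seeley_ext (fun l => a l * b l) b (cderiv u).
Proof.
move=> ab du ddu uM0 uM1 uM2; apply: cvg_cderiv => x'.
have -> : seeley_ext (fun l => a l * b l) b (cderiv u) x' =
    zero_ext (seeley_ext (fun l => a l * b l) b (cderiv u)) (val x').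
  by rewrite /zero_ext valL_in.
move: (val x') => x {x'}.
suff H : diff_quot (seeley_ext a b u) x y @[y --> x^'] -->
    zero_ext (seeley_ext (fun l => a l * b l) b (cderiv u)) x.
  by apply: cvg_trans H; apply: cvg_app; exact: cvg_within.
have ab1 : seeley_seq (fun l => a l * b l) b by have := seeley_seqM 1 ab.
have M20 : 0 <= M2 by exact: le_trans (normc_ge0 _) (uM2 0).
(* The filter is left general to cover the punctured neighbourhood of x < 0 as well as the left
   neighbourhood of 0. At 0 the series formula is valid for both Eu and the candidate derivative, by
   the moments of order 0 and 1. *)
have left_side (F : set_system R) : Filter F -> y @[y --> F] --> x -> x <= 0 ->
    (\forall y \near F, y <= 0 /\ y != x) ->
    diff_quot (seeley_ext a b u) x y @[y --> F] -->
      zero_ext (seeley_ext (fun l => a l * b l) b (cderiv u)) x.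
  move=> FF Fx x0 F0; apply: (@diff_quot_cvg_quadratic _ _ _
      (total_mass (fun l => a l * b l ^+ 2) * M2)) => //.
    by rewrite mulr_ge0// (total_mass_ge0 (seeley_seqM 2 ab)).
  apply: filterS F0 => y [y0 yx]; split=> //.
  rewrite (zero_ext_seeley_le0 ab x0) (zero_ext_seeley_le0 ab y0).
  rewrite (zero_ext_seeley_le0 ab1 x0) -mulrA.
  exact: (seeley_sum_taylor ab du ddu uM0 uM1 uM2).
(* Here Eu coincides with u along [F], so its quotient converges as the one-sided quotient of u
   does; this covers x > 0 and the right neighbourhood of 0. *)
have right_side (F : set_system R) : Filter F -> F `=>` within (domset R HalfLine) x^' ->
    0 <= x -> (\forall y \near F, 0 <= y) ->
    diff_quot (seeley_ext a b u) x y @[y --> F] -->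
      zero_ext (seeley_ext (fun l => a l * b l) b (cderiv u)) x.
  move=> FF Fx x0 F0.
  have Dx : domset R HalfLine x by rewrite domset_half.
  rewrite zero_ext_seeley x0.
  apply: cvg_trans (cvg_trans (cvg_app _ Fx) (zero_ext_cderiv_cvg Dx du)).
  apply: near_eq_cvg; apply: filterS F0 => y y0.
  by rewrite /diff_quot !zero_ext_seeley x0 y0.
have [x0|x0|x0] := ltgtP x 0.
- apply: left_side; [exact: cvg_within|exact: ltW|].
  rewrite near_withinE; have : \forall y \near x, y < 0 by exact: lt_nbhsl.
  by apply: filterS => y /ltW.
- have Dx : \forall y \near x, domset R HalfLine y by exact: near_domset_gt0.
  apply: right_side; [exact: dnbhs_domset|exact: ltW|].
  rewrite near_withinE; have : \forall y \near x, 0 < y by exact: lt_nbhsr.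
  by apply: filterS => y /ltW.
- have Dx : domset R HalfLine x by rewrite domset_half x0.
  apply: cvg_left_right.
    apply: right_side; [exact: at_right_domset|by rewrite x0|].
    by rewrite -x0; exact: nbhs_right_ge.
  apply: left_side; [exact: cvg_within|by rewrite x0|].
  rewrite near_withinE; apply: nearW => y; rewrite x0 => y0.
  by split; [exact: ltW | rewrite lt_eqF].
Qed.

Lemma cderivn_seeley {R : realType} {a b : R^nat} {u : dfun R HalfLine} (j : nat) :
  seeley_seq a b -> Bset u ->
  differentiable_on (cderivn j (seeley_ext a b u)) /\
  cderivn j (seeley_ext a b u) = seeley_ext (fun l => a l * b l ^+ j) b (cderivn j u).
Proof.
move=> ab Bu.
(* One differentiation at order [i] uses the coefficients a_l b_l^i and bounds on three consecutive
   derivatives of u: of the function itself, of its derivative and of the Taylor remainder. *)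
have step i := @cderiv_seeley _ _ _ (cderivn i u) _ _ _ (seeley_seqM i ab)
  (Bu.1 i) (Bu.1 i.+1) (fun z => Bset_bound i z Bu)
  (fun z => Bset_bound i.+1 z Bu) (fun z => Bset_bound i.+2 z Bu).
have E : cderivn j (seeley_ext a b u) =
    seeley_ext (fun l => a l * b l ^+ j) b (cderivn j u).
  elim: j => [|j IH].
    by rewrite (_ : (fun l => _) = a)//; apply/funext => l; rewrite expr0 mulr1.
  have -> : cderivn j.+1 (seeley_ext a b u) =
      cderiv (seeley_ext (fun l => a l * b l ^+ j) b (cderivn j u)) by rewrite -IH.
  apply: etrans (step j).2 _.
  rewrite (_ : (fun l => a l * b l ^+ j.+1) = (fun l => a l * b l ^+ j * b l))//.
  by apply/funext => l; rewrite exprSr mulrA.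
by split=> //; rewrite E; exact: (step j).1.
Qed.

(** * Seminorm bounds, and stability of [Bset] and [B0set] under extension *)

Lemma Linf_seeley_le {R : realType} {a b : R^nat} {u : dfun R HalfLine} :
  seeley_seq a b -> differentiable_on u -> Linf_norm u \is a fin_num ->
  (Linf_norm (seeley_ext a b u) <= (1 + total_mass a)%:E * Linf_norm u)%E.
Proof.
move=> ab du ufin; rewrite Linf_normE; apply/ess_supP; apply: nearW => x /=.
rewrite -(fineK ufin) -EFinM lee_fin zero_ext_seeley mulrDl mul1r.
have um y := normc_le_Linf y du ufin.
have u0 : 0 <= fine (Linf_norm u) by rewrite fine_ge0// Linf_norm_ge0.
(* The summand 1 pays for x >= 0, the total mass for x < 0. *)
case: ifP => _; first by rewrite ler_wpDr// mulr_ge0// (total_mass_ge0 ab).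
by rewrite ler_wpDl//; exact: (seeley_sum_cvg x ab um).2.
Qed.

Lemma differentiable_measurable {R : realType} {f : dfun R Line} (c : R[i]) :
  differentiable_on f ->
  measurable_fun setT (fun x : R => complex.Re (c * zero_ext f x)).
Proof.
move=> df; apply: continuous_measurable_fun => x.
have Dx : \forall y \near x, domset R Line y by exact: (@nearW _ (nbhs x) _).
have [dg _] := is_derive_Re c Dx df.
by apply: differentiable_continuous; exact/derivable1_diffP.
Qed.

Lemma Bset_seeley {R : realType} {a b : R^nat} {u : dfun R HalfLine} :
  seeley_seq a b -> Bset u -> Bset (seeley_ext a b u).
Proof.
move=> ab Bu; split=> j; first exact: (cderivn_seeley j ab Bu).1.
have [df E] := cderivn_seeley j ab Bu; split.
- have := differentiable_measurable 1 df.
  by under eq_fun do rewrite mul1r.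
(* Re(-i z) = Im z, so the imaginary part is covered by the same lemma. *)
- have := differentiable_measurable (- 'i) df.
  rewrite (_ : (fun x => _) = (fun x => complex.Im
    (zero_ext (cderivn j (seeley_ext a b u)) x)))//.
  by apply/funext => x; case: (zero_ext _ x) => p q /=; ring.
- have [_ _ Lu] := Bu.2 j.
  have ufin : Linf_norm (cderivn j u) \is a fin_num.
    by rewrite ge0_fin_numE ?Linf_norm_ge0.
  rewrite E; apply: le_lt_trans (Linf_seeley_le (seeley_seqM j ab) (Bu.1 j) ufin) _.
  by rewrite -(fineK ufin) -EFinM ltry.
Qed.

(** For x >= 0 each derivative of Eu equals that of u, so the limits at +oo are unchanged. *)
Lemma B0set_seeley {R : realType} {a b : R^nat} {u : dfun R HalfLine} :
  seeley_seq a b -> B0set u -> B0set (seeley_ext a b u).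
Proof.
move=> ab [Bu lu]; split; first exact: Bset_seeley.
move=> j; rewrite (cderivn_seeley j ab Bu).2; apply: cvg_trans (lu j).
apply: near_eq_cvg; have : \forall x \near +oo%R, (0 : R) <= x.
  exact: nbhs_pinfty_ge.
by apply: filterS => x x0; rewrite zero_ext_seeley x0.
Qed.

Definition seeley_cst {R : realType} (a b : R^nat) (k : nat) : R :=
  \sum_(j < k.+1) (1 + total_mass (fun l => a l * b l ^+ j)).

Lemma seminorm_seeley_le {R : realType} {a b : R^nat} {u : dfun R HalfLine} (k : nat) :
  seeley_seq a b -> Bset u ->
  fine (seminorm k (seeley_ext a b u)) <= seeley_cst a b k * fine (seminorm k u).
Proof.
move=> ab Bu; rewrite -lee_fin EFinM !fineK ?seminorm_fin//; last exact: Bset_seeley.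
rewrite {1}/seminorm /seeley_cst -sumEFin ge0_sume_distrl; last first.
  by move=> j _; rewrite lee_fin addr_ge0// (total_mass_ge0 (seeley_seqM j ab)).
apply: lee_sum => j _; rewrite (cderivn_seeley j ab Bu).2.
have ufin : Linf_norm (cderivn j u) \is a fin_num.
  by rewrite ge0_fin_numE ?Linf_norm_ge0//; case: (Bu.2 j).
apply: le_trans (Linf_seeley_le (seeley_seqM j ab) (Bu.1 j) ufin) _.
apply: lee_wpmul2l; first by rewrite lee_fin addr_ge0// (total_mass_ge0 (seeley_seqM j ab)).
(* A single derivative norm is at most the whole seminorm, the remaining summands being
   nonnegative. *)
rewrite /seminorm (bigD1 j)//= leeDl//; apply: sume_ge0 => i _.
exact: Linf_norm_ge0.
Qed.

(** [Bset] makes both series converge, which additivity of [limn] requires. *)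
Lemma seeley_ext_lin {R : realType} {a b : R^nat} (c : R[i]) {u v : dfun R HalfLine} :
  seeley_seq a b -> Bset u -> Bset v ->
  seeley_ext a b (c *: u + v) = c *: seeley_ext a b u + seeley_ext a b v.
Proof.
move=> ab Bu Bv; apply/funext => x'.
rewrite [RHS]/(c * seeley_ext a b u x' + seeley_ext a b v x').
rewrite /seeley_ext; case: ifP => _; first exact: zero_ext_lin.
have cu : cvgn (series (seeley_term a b u (val x'))).
  exact: (seeley_sum_cvg _ ab (fun z => Bset_bound 0 z Bu)).1.
have cv : cvgn (series (seeley_term a b v (val x'))).
  exact: (seeley_sum_cvg _ ab (fun z => Bset_bound 0 z Bv)).1.
apply: etrans (lim_series_linear c cu cv).2.
rewrite [seeley_term a b (c *: u + v) _](_ : _ = (fun l =>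
  c * seeley_term a b u (val x') l + seeley_term a b v (val x') l))//.
by apply/funext => l; rewrite /seeley_term zero_ext_lin; ring.
Qed.

Lemma restrict_seeley {R : realType} (a b : R^nat) (u : dfun R HalfLine) :
  restrict_fun (seeley_ext a b u) = u.
Proof.
apply/funext => x; rewrite /restrict_fun /sigL /= zero_ext_seeley.
have : domset R HalfLine (val x) by exact: set_valP.
by rewrite domset_half => ->; rewrite /zero_ext valL_in.
Qed.

(** * Moderate and negligible nets, and the operator on the quotients *)

Lemma bigO_scale_dom {R : realType} {f g h : R -> R} {C : R} :
  (forall e, 0 <= f e <= C * g e) -> g =O_ (0^'+) h -> f =O_ (0^'+) h.
Proof.
(* The constant must be positive whatever the sign of [C], hence the absolute value and the added
   1. *)
move=> fg /eqO_exP[A A0 HA]; apply/eqO_exP; exists (`|C| * A + 1).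
  by rewrite ltr_wpDl// mulr_ge0// ltW.
near=> e; have /andP[f0 fge] := fg e; rewrite ger0_norm//.
apply: le_trans fge _; apply: le_trans (ler_norm _) _; rewrite normrM.
have HAe : `|g e| <= A * `|h e| by near: e; exact: HA.
apply: le_trans (ler_wpM2l (normr_ge0 C) HAe) _.
by rewrite mulrA ler_wpM2r// lerDl.
Unshelve. all: by end_near. Qed.

Definition seeley_net {R : realType} (a b : R^nat) (u : epsilons R -> dfun R HalfLine) :
  epsilons R -> dfun R Line := fun e => seeley_ext a b (u e).

Lemma bigO_seeley {R : realType} {a b : R^nat} {u : epsilons R -> dfun R HalfLine}
    {k : nat} {h : R -> R} : seeley_seq a b -> (forall e, Bset (u e)) ->
  net_seminorm k u =O_ (0^'+) h ->
  net_seminorm k (seeley_net a b u) =O_ (0^'+) h.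
Proof.
move=> ab Bu; apply: (@bigO_scale_dom _ _ _ _ (seeley_cst a b k)) => e.
rewrite net_seminorm_ge0 /net_seminorm /seeley_net /valL_ /=.
case: ('oinv_set_val e) => [z|] /=; first exact: seminorm_seeley_le.
(* Outside ]0, 1] nets take the default value 0, so E0 = 0 is needed; it follows from linearity as
   E(-0 + 0) = -E0 + E0. *)
have -> : (0 : dfun R Line) = seeley_ext a b 0.
  have B0 := @Bset0 R HalfLine.
  have := seeley_ext_lin (-1) ab B0 B0.
  by rewrite !scaleN1r !addNr.
exact: seminorm_seeley_le (@Bset0 R HalfLine).
Qed.

(** Abstract spaces [X] and [Y] let one construction serve both the bounded functions and those
    vanishing at +oo with all derivatives. *)
Lemma seeley_net_moderate {R : realType} {a b : R^nat} {X : fspace R HalfLine}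
    {Y : fspace R Line} (ab : seeley_seq a b)
    (XY : forall u, X u -> Y (seeley_ext a b u)) (u : mnet X) :
  seeley_net a b u \in moderate Y.
Proof.
have /moderateP[Xu Mu] := mnetP u; apply/moderateP; split=> [e|k]; first exact: XY.
have [m Hm] := Mu k; exists m; apply: bigO_seeley Hm => // e.
exact: fspace_sub (Xu e).
Qed.

Definition seeley_mnet {R : realType} {a b : R^nat} {X : fspace R HalfLine}
    {Y : fspace R Line} (ab : seeley_seq a b)
    (XY : forall u, X u -> Y (seeley_ext a b u)) (u : mnet X) : mnet Y :=
  MNet (seeley_net_moderate ab XY u).

Lemma seeley_mnet_lin {R : realType} {a b : R^nat} {X : fspace R HalfLine}
    {Y : fspace R Line} (ab : seeley_seq a b)
    (XY : forall u, X u -> Y (seeley_ext a b u)) (c : R[i]) (u v : mnet X) :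
  seeley_mnet ab XY (c *: u + v) = c *: seeley_mnet ab XY u + seeley_mnet ab XY v.
Proof.
apply/val_inj/funext => e.
have /moderateP[Xu _] := mnetP u; have /moderateP[Xv _] := mnetP v.
exact: (seeley_ext_lin c ab (fspace_sub (Xu e)) (fspace_sub (Xv e))).
Qed.

Definition Gseeley {R : realType} {a b : R^nat} {X : fspace R HalfLine}
    {Y : fspace R Line} (ab : seeley_seq a b)
    (XY : forall u, X u -> Y (seeley_ext a b u)) (w : Galg X) : Galg Y :=
  Gclass (seeley_mnet ab XY (Grepr w)).

(** Independence of the representative: two representatives differ by a negligible net, linearity
    carries the difference through E, and the seminorm bounds keep it negligible. *)
Lemma Gseeley_class {R : realType} {a b : R^nat} {X : fspace R HalfLine}
    {Y : fspace R Line} (ab : seeley_seq a b)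
    (XY : forall u, X u -> Y (seeley_ext a b u)) (u : mnet X) :
  Gseeley ab XY (Gclass u) = Gclass (seeley_mnet ab XY u).
Proof.
apply/Gclass_eq; apply/asboolP => k m.
have /Gclass_eq/asboolP/(_ k m) := GreprK (Gclass u).
set v := Grepr _ => vu.
have -> : seeley_mnet ab XY v - seeley_mnet ab XY u = seeley_mnet ab XY (v - u).
  by have := seeley_mnet_lin ab XY (-1) u v; rewrite !scaleN1r ![- _ + _]addrC.
apply: bigO_seeley vu => // e.
have /moderateP[Xu _] := mnetP (v - u); exact: fspace_sub (Xu e).
Qed.

Lemma Gseeley_linear {R : realType} {a b : R^nat} {X : fspace R HalfLine}
    {Y : fspace R Line} (ab : seeley_seq a b)
    (XY : forall u, X u -> Y (seeley_ext a b u)) : linear (Gseeley ab XY).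
Proof.
move=> c w z; rewrite -[w]GreprK -[z]GreprK -Gclass_lin !Gseeley_class.
by rewrite seeley_mnet_lin Gclass_lin.
Qed.

Theorem theorem2 (R : realType) (a b : R^nat)
  (b_lt0 : forall l, b l < 0)
  (ab_summable : forall n : nat, cvgn (series (fun l => `|a l| * `|b l| ^+ n)))
  (ab_moments : forall n : nat,
    series (fun l => a l * b l ^+ n) @ \oo --> (1 : R))
  (b_to_ninfty : b @ \oo --> -oo) :
  (forall (u : dfun R HalfLine) (x : R), Bset u -> x < 0 ->
    cvgn (series (seeley_term a b u x))) /\
  exists E : {linear Galg (Bspace R HalfLine) -> Galg (Bspace R Line)},
    [/\ induced_by (seeley_ext a b) E,
        forall u : Galg (Bspace R HalfLine), Grestrict (E u) = u &
        forall u : Galg (B0space R HalfLine),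
          exists v : Galg (B0space R Line), E (Gembed u) = Gembed v].
Proof.
have ab : seeley_seq a b by [].
split=> [u x Bu _|].
  exact: (seeley_sum_cvg x ab (fun z => Bset_bound 0 z Bu)).1.
have BB u : Bspace R HalfLine u -> Bspace R Line (seeley_ext a b u).
  exact: Bset_seeley.
have BB0 u : B0space R HalfLine u -> B0space R Line (seeley_ext a b u).
  exact: B0set_seeley.
pose E : {linear Galg (Bspace R HalfLine) -> Galg (Bspace R Line)} :=
  HB.pack (Gseeley ab BB)
    (GRing.isLinear.Build _ _ _ _ (Gseeley ab BB) (Gseeley_linear ab BB)).
exists E; split.
- by move=> u; exists (seeley_mnet ab BB u); split=> //; exact: Gseeley_class.
- move=> w; rewrite -[w]GreprK [E _]Gseeley_class Grestrict_class.
  (* The equality holds exactly for each function of the net, not only modulo negligible nets. *)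
  congr Gclass; apply/val_inj/funext => e; exact: restrict_seeley.
(* The same extension, run inside the [B0space] quotients, is the witness; both sides are classes of
   one and the same net. *)
- move=> w; exists (Gseeley ab BB0 w).
  rewrite -[w]GreprK Gembed_class [E _]Gseeley_class Gseeley_class Gembed_class.
  by congr Gclass; exact: val_inj.
Qed.
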